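(* Let $\mathbf X_0$ be a random variable taking values in a real Banach space $E$, and let $r\in[1,\infty)$. If $\mathbf z$ and $\mathbf m$ are any deterministic vectors in $E$, then $$\|\mathbf z\|^r\,[1-d_{\mathrm{TV}}(\mathbf X_0,\mathbf X_0+\mathbf z)]\le2^{r-1}\,\mathbb E\|\mathbf X_0-\mathbf m\|^r.$$ Furthermore, for any continuous linear functional $\chi\in E^*$ and any $m\in\mathbb R$, $$|\chi(\mathbf z)|^r\,[1-d_{\mathrm{TV}}(\mathbf X_0,\mathbf X_0+\mathbf z)]\le2^{r-1}\,\mathbb E|\chi(\mathbf X_0)-m|^r.$$
   Context: $E$ is equipped with its Borel $\sigma$-algebra. $d_{\mathrm{TV}}(\mathbf Y,\tilde{\mathbf Y})=\sup_B|\mathbb P(\mathbf Y\in B)-\mathbb P(\tilde{\mathbf Y}\in B)|$ (supremum over measurable sets $B$) is the total variation distance between the distributions of $\mathbf Y$ and $\tilde{\mathbf Y}$; it equals $\frac12\int|f-\tilde f|\,d\mu=1-\int\min\{f,\tilde f\}\,d\mu$ for any $\sigma$-finite measure $\mu$ with respect to which both distributions have densities $f,\tilde f$. The right-hand sides are allowed to be $+\infty$. *)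

(* Defs.v *)
From HB Require Import structures.
From mathcomp Require Import all_boot all_order all_algebra.
From mathcomp Require Import all_classical all_reals all_analysis.

Set Implicit Arguments.
Unset Strict Implicit.
Unset Printing Implicit Defensive.
Import Order.TTheory GRing.Theory Num.Theory.
Import numFieldNormedType.Exports.

Local Open Scope classical_set_scope.
Local Open Scope ring_scope.

(* The space [E] with its Borel sigma-algebra.  The library attaches no
   sigma-algebra to a general topological type, so this is an alias of [E] on
   which measurability is the sigma-algebra generated by the open sets; the
   Banach space structure of [E] is transported to it unchanged. *)
Definition borel_space (R : realType) (E : completeNormedModType R) : Type :=
  g_sigma_algebraType (@open E).

HB.instance Definition _ (R : realType) (E : completeNormedModType R) :=
  Measurable.copy (borel_space E) (g_sigma_algebraType (@open E)).
HB.instance Definition _ (R : realType) (E : completeNormedModType R) :=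
  CompleteNormedModule.copy (borel_space E) E.

Section translation.
Context d (T : measurableType d) (R : realType) (E : completeNormedModType R).

Definition translate (X : T -> borel_space E) (z : E) : T -> borel_space E :=
  fun w => X w + z.

Lemma measurable_translate (X : {mfun T >-> borel_space E}) (z : E) :
  measurable_fun [set: T] (translate X z).
Proof.
apply: (@measurability _ _ T (borel_space E) _ _ (@open E)); first by [].
move=> _ [U oU <-]; rewrite setTI.
rewrite [_ @^-1` _](_ : _ = X @^-1` ((fun x : E => x + z) @^-1` U)) //.
rewrite -[X in measurable X]setTI.
apply: (@measurable_funP _ _ _ _ _ X) => //.
apply: sub_sigma_algebra.
apply: (open_comp (f := fun x : E => x + z)) => // x _.
by apply: cvgD; [exact: cvg_id|exact: cvg_cst].
Qed.

HB.instance Definition _ (X : {mfun T >-> borel_space E}) (z : E) :=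
  isMeasurableFun.Build _ _ T (borel_space E) (translate X z)
    (measurable_translate X z).

End translation.

(* The set below is nonempty and bounded by 1, so the real-valued [sup] is the
   actual supremum. *)
Definition dTV d d' (T : measurableType d) (S : measurableType d')
    (R : realType) (P : probability T R) (Y Y' : {RV P >-> S}) : R :=
  sup [set `|fine (distribution P Y B) - fine (distribution P Y' B)|
      | B in @measurable d' S].

(* Main.v *)
Require Import Defs.
From mathcomp Require Import all_boot all_order all_algebra.
From mathcomp Require Import all_classical all_reals all_analysis.
From mathcomp Require Import measurable_realfun ring lra.

Set Implicit Arguments.
Unset Strict Implicit.
Unset Printing Implicit Defensive.
Import Order.TTheory GRing.Theory Num.Theory.
Import numFieldNormedType.Exports.

Local Open Scope classical_set_scope.
Local Open Scope ring_scope.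

(** Both inequalities concern a continuous map [g] with values in a normed
    space that turns the translation by [z] into the translation by a vector
    [w]: either [g x = x - m] and [w = z], or [g x = chi x - m] and
    [w = chi z]. The case [w = 0] is trivial. Otherwise put [a x = |g x| / |w|]
    and [C x = 2^(r-1) (a x)^r]; the claim becomes
    [1 - dTV X0 (X0 + z) <= E (C (X0))].

    The quantity [1 - dTV] is the largest mass that the laws of [X0] and
    [X0 + z] have in common, and the bound is obtained by duality
    ([dTV_weak_duality]): it is enough to find a measurable [h] with values in
    [0, 1] such that [1 + h x <= C x + h (x + z)] for all [x]. Integrating along
    [X0] gives [1 + E h(X0) <= E C(X0) + E h(X0 + z)], and the expectations of
    [h] under the two laws differ by at most the total variation distance.

    Integrating only the inequality [C (x - z) + C x >= 1] against the common
    part loses a factor 2. The constant is sharp (take [X0] uniform on two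
    points at distance [z], and [m] their midpoint), so [h] has to be chosen
    with care. As [h] takes its values in [0, 1], the required inequalities at
    [x] and at [x - z] force [1 - C (x - z) <= h x <= C x]. The function
    [potential] takes the truncated upper bound at the points where
    [a (x - z) < a x] and the truncated lower bound elsewhere; on the real line,
    with [g x = x] and [w = 1], it is 0 before 0 and 1 after 1. That it works is
    a statement on the three numbers [a (x - z)], [a x], [a (x + z)], which are
    constrained by the triangle inequality only ([potential_step]). *)

(** * The total variation distance tests functions with values in [0, 1] *)

Lemma le_dTV d d' (T : measurableType d) (S : measurableType d')
    (R : realType) (P : probability T R) (Y Y' : {RV P >-> S}) (B : set S) :
  measurable B ->
  (distribution P Y' B <= distribution P Y B + (dTV Y Y')%:E)%E.
Proof.
move=> mB.
have fin (Z : {RV P >-> S}) : distribution P Z B \is a fin_num.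
  exact: fin_num_measure.
rewrite -(fineK (fin Y)) -(fineK (fin Y')) -EFinD lee_fin addrC -lerBlDr.
apply: (@le_trans _ _
  `|fine (distribution P Y B) - fine (distribution P Y' B)|).
  by rewrite distrC ler_norm.
apply: ub_le_sup; last by exists B.
exists 1 => _ [C mC <-].
have bnd (Z : {RV P >-> S}) : 0 <= fine (distribution P Z C) <= 1.
  rewrite fine_ge0//= -lee_fin fineK; first exact: probability_le1.
  exact: fin_num_measure.
by move: (bnd Y) (bnd Y') => /andP[? ?] /andP[? ?]; rewrite ler_norml; lra.
Qed.

(** By the layer-cake formula, [h] is an average of indicators of its
    superlevel sets at levels in [0, 1], and each of them is a set over which
    the supremum defining the distance ranges. *)
Lemma expectation_comp_le_dTV d d' (T : measurableType d)
    (S : measurableType d') (R : realType) (P : probability T R)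
    (Y Y' : {RV P >-> S}) (h : {mfun S >-> R}) :
  (forall s, 0 <= h s <= 1) ->
  ('E_P[h \o Y'] <= 'E_P[h \o Y] + (dTV Y Y')%:E)%E.
Proof.
move=> h01.
have h0 (Z : {RV P >-> S}) w : 0 <= (h \o Z) w by have /andP[] := h01 (Z w).
have dTV0 : 0 <= dTV Y Y'.
  have := @le_dTV _ _ _ _ _ _ Y Y' setT measurableT.
  by rewrite !probability_setT -EFinD lee_fin lerDl.
rewrite (ge0_expectation_ccdf (h0 Y)) (ge0_expectation_ccdf (h0 Y')).
set mu := lebesgue_measure; set D := `[0, +oo[%classic.
have mD : measurable (D : set R) by exact: measurable_itv.
have mI : measurable (`[0, 1]%classic : set R) by exact: measurable_itv.
have mI' : measurable_fun D
    (fun s => (dTV Y Y')%:E * (\1_(`[0, 1]%classic : set R) s)%:E)%E.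
  apply/measurable_EFinP; apply: measurable_funM; first exact: measurable_cst.
  exact: measurable_indic.
have mC (Z : {RV P >-> R}) : measurable_fun D (ccdf Z).
  by apply: measurable_funTS; exact: ccdf_measurable.
have mu1 : mu (`[0, 1]%classic : set R) = 1%E.
  by rewrite /mu lebesgue_measure_itv/= lte_fin ltr01 sube0.
(* The bound on each level is the distance for levels up to 1, and 0 beyond,
   since [h <= 1]. *)
have -> : (dTV Y Y')%:E =
    (\int[mu]_(s in D) ((dTV Y Y')%:E * (\1_`[0, 1] s)%:E))%E.
  rewrite ge0_integralZl_EFin//; last first.
    by apply/measurable_EFinP; exact: measurable_indic.
  rewrite integral_indic// setIidl.
    by rewrite [X in (_ * X)%E](_ : _ = 1%E)// mule1.
  by move=> s; rewrite /D/= !in_itv/= andbT => /andP[].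
rewrite -ge0_integralD//; last first.
- by move=> s _; rewrite -EFinM lee_fin mulr_ge0.
- exact: mC.
apply: ge0_le_integral => //.
- exact: mC.
- apply: emeasurable_funD; first exact: mC.
  exact: mI'.
move=> s; rewrite /D/= in_itv/= andbT => s0.
have [s1|s1] := leP s 1.
  rewrite indicE mem_set/= ?in_itv/= ?s0// mule1.
  have mB : measurable (h @^-1` `]s, +oo[).
    by rewrite -[X in measurable X]setTI; exact: measurable_funPT.
  exact: (le_dTV Y Y' mB).
rewrite [leLHS](_ : _ = 0%E) ?adde_ge0 ?mule_ge0//.
rewrite /ccdf /distribution /pushforward/= [X in P X](_ : _ = set0)//.
apply/seteqP; split => // w /=; rewrite in_itv/= andbT.
by have /andP[_ ?] := h01 (Y' w); lra.
Qed.

(** The pair [(C, h)] is a feasible point of the linear program dual to the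
    maximization of the common mass of the laws of [Y] and [Y'], so its value
    bounds that mass. The function [C] may have infinite expectation, whereas
    the expectation of [h] is finite and can be cancelled. *)
Lemma dTV_weak_duality d d' (T : measurableType d) (S : measurableType d')
    (R : realType) (P : probability T R) (Y Y' : {RV P >-> S})
    (h : S -> R) (C : T -> R) :
  measurable_fun [set: S] h -> (forall s, 0 <= h s <= 1) ->
  measurable_fun [set: T] C -> (forall t, 0 <= C t) ->
  (forall t, 1 + h (Y t) <= C t + h (Y' t)) ->
  ((1 - dTV Y Y')%:E <= 'E_P[C])%E.
Proof.
move=> mh h01 mC C0 step.
pose hm : {mfun S >-> R} := mfun_Sub (mem_set mh).
have dle : ('E_P[h \o Y'] <= 'E_P[h \o Y] + (dTV Y Y')%:E)%E.
  exact: (expectation_comp_le_dTV Y Y' (h := hm)).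
have h0 (Z : {RV P >-> S}) t : 0 <= (h \o Z) t by case/andP: (h01 (Z t)).
have mhY (Z : {RV P >-> S}) : measurable_fun [set: T] (h \o Z).
  exact: measurableT_comp.
have mE (f : T -> R) : measurable_fun [set: T] f ->
    measurable_fun [set: T] (fun t => (f t)%:E) by move/measurable_EFinP.
have finh : ('E_P[h \o Y] \is a fin_num)%E.
  rewrite ge0_fin_numE; last exact: expectation_ge0.
  apply: (@le_lt_trans _ _ 'E_P[cst 1%R]%E); last first.
    by rewrite expectation_cst ltry.
  apply: expectation_le => //.
  by apply: aeW => t; case/andP: (h01 (Y t)).
have intstep : (1 + 'E_P[h \o Y] <= 'E_P[C] + 'E_P[h \o Y'])%E.
  rewrite -(expectation_cst P 1) unlock -!ge0_integralD//; first last.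
  - exact: mE.
  - by move=> t _; rewrite lee_fin.
  - exact: mE.
  - exact: mE.
  - by move=> t _; rewrite lee_fin.
  - exact: mE.
  - by move=> t _; rewrite lee_fin.
  apply: ge0_le_integral => //.
  - by move=> t _; rewrite -EFinD lee_fin addr_ge0.
  - by apply: emeasurable_funD; exact: mE.
  - by apply: emeasurable_funD; exact: mE.
  by move=> t _; rewrite -!EFinD lee_fin; exact: step.
move: (le_trans intstep (leeD2l _ dle)).
by rewrite addeCA addeC leeD2rE// EFinB leeBlDr.
Qed.

(** * The dual potential *)

Section potential.
Context {R : realType} (r : R).
Hypothesis r1 : 1 <= r.

Definition cost (a : R) : R := 2 `^ (r - 1) * a `^ r.

Lemma cost_ge0 a : 0 <= cost a.
Proof. by rewrite mulr_ge0 ?powR_ge0. Qed.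

Lemma cost_ge1 a : 1 <= a -> 1 <= cost a.
Proof.
move=> a1; have p1 : (1 : R) <= 2 `^ (r - 1).
  by rewrite -[leLHS](powRr0 2) ler_powR ?ler1n// subr_ge0.
have q1 : 1 <= a `^ r by exact: (le_trans a1 (le1r_powR a1 r1)).
by rewrite -[leLHS]mulr1 ler_pM.
Qed.

(** The factor [2 `^ (r - 1)] is what the convexity of the power function at the
    midpoint of [a] and [b] requires. *)
Lemma cost_add_ge1 a b : 0 <= a -> 0 <= b -> 1 <= a + b ->
  1 <= cost a + cost b.
Proof.
move=> a0 b0 ab.
have r0 : 0 < r by apply: lt_le_trans r1.
have cvx : (2^-1 * a + 2^-1 * b) `^ r <= 2^-1 * a `^ r + 2^-1 * b `^ r.
  rewrite {2 4}(_ : 2^-1 = 1 - 2^-1); last by field.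
  by apply: (convex_powR r1 (Itv01 _ _)) => //=;
    rewrite ?inE/= ?in_itv/= ?andbT// ?invr_ge0// invf_le1 ?ler1n.
rewrite (_ : cost a + cost b = 2 `^ r * (2^-1 * a `^ r + 2^-1 * b `^ r)).
  apply: le_trans (ler_wpM2l (powR_ge0 _ _) cvx).
  rewrite -powRM//; last by lra.
  rewrite (_ : 2 * _ = a + b); last by field.
  exact: (le_trans ab (le1r_powR ab r1)).
by rewrite /cost -(mulr_powRB1 (x := 2) _ r0)//; field.
Qed.

(** With [b] and [a] the rescaled norms of [g] at [x] and at [x - z], the value of the dual potential at [x]:
    one of the two bounds [cost b] and [1 - cost a] between which it must lie,
    according to which of [x] and [x - z] has the smaller one. *)
Definition potential (b a : R) : R :=
  if a < b then Order.min 1 (cost b) else Order.max 0 (1 - cost a).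

Lemma potential_itv b a : 0 <= potential b a <= 1.
Proof.
rewrite /potential; have := cost_ge0 a; have := cost_ge0 b.
case: ifP => _ b0 a0; first by case: (leP 1 (cost b)) => ?; lra.
by case: (leP 0 (1 - cost a)) => ?; lra.
Qed.

(** The numbers [a], [b], [c] stand for the norms of [v - w], [v], [v + w] with
    [|w| = 1], and the last four hypotheses are the triangle inequalities
    between them. In every case at least one of [cost a] and [cost c] is at
    least 1, because [2 <= a + c]. *)
Lemma potential_step a b c : 0 <= a -> 0 <= b -> 0 <= c ->
  1 <= a + b -> 1 <= b + c -> 2 <= a + c -> 2 * b <= a + c ->
  1 + potential b a <= cost b + potential c b.
Proof.
move=> a0 b0 c0 ab bc ac bac; rewrite /potential.
have Gb := cost_ge0 b.
have Gab := cost_add_ge1 a0 b0 ab.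
have Gbc := cost_add_ge1 b0 c0 bc.
case: ltP => ba; case: ltP => cb.
- have Gc : 1 <= cost c by apply: cost_ge1; lra.
  by rewrite (min_l Gc); case: (leP 1 (cost b)); lra.
(* [a < b] and [c <= b] contradict the convexity of the norm. *)
- lra.
- have [a1|a1] := leP 1 a.
    have Ga := cost_ge1 a1.
    by case: (leP 0 (1 - cost a)); case: (leP 1 (cost c)); lra.
  have Gc : 1 <= cost c by apply: cost_ge1; lra.
  by case: (leP 0 (1 - cost a)); case: (leP 1 (cost c)); lra.
- have Ga : 1 <= cost a by apply: cost_ge1; lra.
  by case: (leP 0 (1 - cost a)); case: (leP 0 (1 - cost b)); lra.
Qed.

End potential.

(** * Moments of maps that intertwine two translations *)

Lemma continuous_measurable_borel (R : realType) (E : completeNormedModType R)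
    (f : E -> R) :
  continuous f -> measurable_fun [set: borel_space E] (f : borel_space E -> R).
Proof.
move=> cf; apply: (measurability _ (RGenOInfty.measurableE R)).
move=> _ [_ [x ->] <-]; rewrite setTI.
apply: sub_sigma_algebra; apply: (open_comp (f := f)) => [y _|]; first exact: cf.
exact: rray_open.
Qed.

(** Only the values of the norm of [g] along the orbits of the translation
    matter, which is why the norm of [E] and a functional are treated at once. *)
Lemma equivariant_moment d (T : measurableType d) (R : realType)
    (P : probability T R) (E : completeNormedModType R) (V : normedModType R)
    (X0 : {RV P >-> borel_space E}) (r : R) (z : E) (g : E -> V) (w : V) :
  1 <= r -> continuous g -> (forall x, g (x + z) = g x + w) ->
  ((`|w| `^ r * (1 - dTV X0 (translate X0 z)))%:E
     <= (2 `^ (r - 1))%:E * 'E_P[fun t => (`|g (X0 t)| `^ r)%R])%E.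
Proof.
move=> r1 cg gz.
have [->|w0] := eqVneq w 0.
  rewrite normr0 powR0 ?gt_eqF ?(lt_le_trans _ r1)// mul0r mule_ge0//.
  by apply: expectation_ge0 => t; exact: powR_ge0.
have c0 : 0 < `|w| by rewrite normr_gt0.
pose a (x : E) := `|g x| / `|w|.
have a0 x : 0 <= a x by rewrite divr_ge0.
have ca : continuous a.
  move=> x; apply: cvgM; last exact: cvg_cst.
  by apply: cvg_norm; exact: cg.
pose h (x : borel_space E) : R := potential r (a x) (a (x - z)).
have mcost (f : borel_space E -> R) : measurable_fun setT f ->
    measurable_fun setT (fun x => cost r (f x)).
  move=> mf; apply: measurable_funM; first exact: measurable_cst.
  exact: (measurableT_comp (measurable_powR _)).
have ma : measurable_fun setT (a : borel_space E -> R).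
  exact: continuous_measurable_borel.
have ma' : measurable_fun setT ((fun x => a (x - z)) : borel_space E -> R).
  apply: (continuous_measurable_borel (f := fun x : E => a (x - z))) => x.
  apply: (continuous_comp (f := fun x : E => x - z)); last exact: ca.
  by apply: cvgB; [exact: cvg_id|exact: cvg_cst].
have mh : measurable_fun setT h.
  apply: measurable_fun_ifT.
  - exact: measurable_fun_ltr.
  - apply: measurable_minr; first exact: measurable_cst.
    exact: mcost.
  - apply: measurable_maxr; first exact: measurable_cst.
    apply: measurable_funB; first exact: measurable_cst.
    exact: mcost.
have h01 x : 0 <= h x <= 1 by exact: potential_itv.
(* The triangle inequalities for [g x - w], [g x], [g x + w], divided by
   the norm of [w]. *)
have step (x : E) : 1 + h x <= cost r (a x) + h (x + z).
  have gz' : g (x - z) = g x - w by rewrite -(addrK w (g (x - z))) -gz subrK.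
  have bnd (u v : V) (k : R) : k * `|w| <= `|u| + `|v| ->
      k <= `|u| / `|w| + `|v| / `|w|.
    by move=> ?; rewrite -mulrDl ler_pdivlMr.
  rewrite /h addrK; apply: potential_step => //; rewrite /a ?gz' ?gz.
  - apply: bnd; rewrite mul1r addrC.
    by have := ler_normB (g x) (g x - w); rewrite subKr.
  - apply: bnd; rewrite mul1r addrC.
    by have := ler_normB (g x + w) (g x); rewrite addrAC subrr add0r.
  - apply: bnd; rewrite -[2]ger0_norm// -normrZ.
    rewrite (_ : 2 *: w = (g x + w) - (g x - w)).
      by rewrite [leRHS]addrC ler_normB.
    by rewrite opprB [w - g x]addrC addrACA subrr add0r scaler_nat.
  - rewrite mulrA -mulrDl ler_pM2r ?invr_gt0//.
    rewrite -[2]ger0_norm// -normrZ.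
    rewrite (_ : 2 *: g x = (g x - w) + (g x + w)) ?ler_normD//.
    by rewrite addrACA addNr addr0 scaler_nat.
have mcX : measurable_fun setT (fun t => cost r (a (X0 t))).
  exact: (measurableT_comp (mcost _ ma)).
have dual : ((1 - dTV X0 (translate X0 z))%:E
    <= 'E_P[fun t => cost r (a (X0 t))])%E.
  apply: (dTV_weak_duality mh h01 mcX) => [t|t]; first exact: cost_ge0.
  exact: step.
have mgX : measurable_fun setT (fun t => `|g (X0 t)| `^ r).
  apply: (measurableT_comp (measurable_powR r)).
  have mg : measurable_fun setT ((fun x => `|g x|) : borel_space E -> R).
    apply: (continuous_measurable_borel (f := fun x : E => `|g x|)) => x.
    by apply: cvg_norm; exact: cg.
  exact: (measurableT_comp mg).
have wr0 : 0 < `|w| `^ r by rewrite powR_gt0.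
rewrite EFinM; apply: le_trans (lee_wpmul2l _ dual) _.
  by rewrite lee_fin ltW.
rewrite unlock -!ge0_integralZl_EFin ?powR_ge0//; first last.
- by apply/measurable_EFinP.
- by move=> t _; rewrite lee_fin cost_ge0.
- by apply/measurable_EFinP.
rewrite le_eqVlt; apply/orP; left; apply/eqP; apply: eq_integral => t _.
rewrite -!EFinM; congr EFin; rewrite /cost mulrCA -powRM//.
by rewrite /a [X in X `^ r]mulrC divfK// gt_eqF.
Qed.

Theorem theoremC1 (d : measure_display) (T : measurableType d) (R : realType)
    (P : probability T R) (E : completeNormedModType R)
    (X0 : {RV P >-> borel_space E}) (r : R) (hr : 1 <= r) (z : E) :
  (forall m : E,
    ((`|z| `^ r
       * (1 - dTV X0 (translate X0 z)))%:E
     <= (2 `^ (r - 1))%:E * 'E_P[fun w => (`|X0 w - m| `^ r)%R])%E) /\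
  (forall (chi : {linear E -> R^o}) (hchi : continuous chi) (m : R),
    ((`|chi z| `^ r
       * (1 - dTV X0 (translate X0 z)))%:E
     <= (2 `^ (r - 1))%:E * 'E_P[fun w => (`|chi (X0 w) - m| `^ r)%R])%E).
Proof.
split=> [m|chi hchi m].
  have cg : continuous (fun x : E => x - m).
    by move=> x; apply: cvgB; [exact: cvg_id|exact: cvg_cst].
  by apply: (equivariant_moment _ _ cg) => // x; rewrite addrAC.
have cg : continuous (fun x : E => chi x - m : R^o).
  by move=> x; apply: cvgB; [exact: hchi|exact: cvg_cst].
by apply: (equivariant_moment _ _ cg) => // x; rewrite linearD addrAC.
Qed.
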